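(* Let $\mathcal Q$ be a countable set, $\eta:\mathcal Q\to[0,1]$ injective (ordering $\mathcal Q$ by $i<j$ iff $\eta(i)<\eta(j)$), $(\Gamma_i)_{i\in\mathcal Q}$ tournament limits, and $(\alpha_i)_{i\in\mathcal Q}$ positive numbers with $\sum_{i\in\mathcal Q}\alpha_i=1$. Then there is a unique tournament limit $\Gamma$ such that for every finite tournament $F$, $$t_{\mathrm{ind}}(F,\Gamma)=\sum_{(F_i)\in\mathcal P(F,\mathcal Q)}\prod_{i\in\mathcal Q}\alpha_i^{v(F_i)}\,t_{\mathrm{ind}}(F_i,\Gamma_i).$$
   Context: A tournament is a loopless digraph with exactly one edge between any two distinct vertices. For finite digraphs $t(F,G)=\hom(F,G)/v(G)^{v(F)}$; $t_{\mathrm{ind}}(F,G)=\mathrm{ind}(F,G)/(v(G))_{v(F)}$ with $\mathrm{ind}$ counting injective maps preserving edges and non-edges. A tournament limit is the limit of a sequence of finite tournaments $(G_n)$, $v(G_n)\to\infty$, with $t(F,G_n)$ convergent for every finite digraph $F$; $t_{\mathrm{ind}}(F,\Gamma)=\lim t_{\mathrm{ind}}(F,G_n)$, and a tournament limit is determined by its values $t_{\mathrm{ind}}(F,\cdot)$ over finite tournaments $F$. Conventions: $t_{\mathrm{ind}}(\emptyset,\cdot)=1$, $0^0=1$. $\mathcal P(F,\mathcal Q)$ is the set of families $(F_i)_{i\in\mathcal Q}$ of (possibly empty, all but finitely many empty) induced subtournaments of $F$ whose vertex sets partition $V(F)$ such that for $i<j$ every edge between $V(F_i)$ and $V(F_j)$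 goes from $V(F_i)$ to $V(F_j)$. *)

(* Defs.v *)
From HB Require Import structures.
From mathcomp Require Import all_boot all_order all_algebra.
From mathcomp Require Import all_classical all_reals all_analysis.

Set Implicit Arguments.
Unset Strict Implicit.
Unset Printing Implicit Defensive.

Import Order.TTheory GRing.Theory Num.Theory.
Import numFieldNormedType.Exports.

Local Open Scope classical_set_scope.
Local Open Scope ring_scope.

(* Loops and antiparallel edges are allowed in a general digraph. *)
Record digraph := Digraph {
  vertex :> finType;
  edge : rel vertex }.

Definition is_tournament (G : digraph) : Prop :=
  irreflexive (@edge G) /\
  forall x y : G, x != y -> edge x y (+) edge y x.

Record tournament := Tournament {
  tournament_digraph :> digraph;
  tournamentP : is_tournament tournament_digraph }.

Definition hom_count (F G : digraph) : nat :=
  #|[pred f : {ffun F -> G} |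
      [forall x, forall y, edge x y ==> edge (f x) (f y)]]|.

Definition ind_count (F G : digraph) : nat :=
  #|[pred f : {ffun F -> G} |
      injectiveb f && [forall x, forall y, edge x y == edge (f x) (f y)]]|.

Section Density.
Variable R : realType.

Definition hom_density (F G : digraph) : R :=
  (hom_count F G)%:R / (#|G| ^ #|F|)%N%:R.

Definition ind_density (F G : digraph) : R :=
  (ind_count F G)%:R / (#|G| ^_ #|F|)%N%:R.

Definition tournament_cvg (G : nat -> tournament) (t : digraph -> R) : Prop :=
  ((#|G n|%:R : R) @[n --> \oo] --> +oo) /\
  (forall F : digraph, hom_density F (G n) @[n --> \oo] --> t F).

(* A limit object is identified with the family of its homomorphism densities
   t(F, .) over all finite digraphs F. *)
Record tournament_limit := TournamentLimit {
  limit_density :> digraph -> R;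
  limit_densityP : exists G : nat -> tournament,
    tournament_cvg G limit_density }.

Definition limit_sequence (Gamma : tournament_limit) : nat -> tournament :=
  sval (cid (limit_densityP Gamma)).

(* By [ind_density_cvg] below, this does not depend on the choice of the
   sequence converging to Gamma. *)
Definition limit_ind_density (F : digraph) (Gamma : tournament_limit) : R :=
  lim (ind_density F (limit_sequence Gamma n) @[n --> \oo]).

End Density.

Section Induced.
Variables (F : tournament) (A : {set F}).

Definition induced_digraph : digraph :=
  @Digraph {x : F | x \in A} (fun x y => edge (val x) (val y)).

Lemma induced_is_tournament : is_tournament induced_digraph.
Proof.
case: (tournamentP F) => irr tot; split=> [x|x y xy]; first exact: irr.
by apply: tot; rewrite (inj_eq val_inj).
Qed.

Definition induced_tournament : tournament := Tournament induced_is_tournament.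

End Induced.
Arguments induced_tournament F A : clear implicits.

(* An induced subtournament is given by its vertex set, so a family (F_i) is
   encoded by the vertex sets V i of its members. *)
Definition ordered_partitions (R : realType) (Q : countType) (eta : Q -> R)
    (F : tournament) : set (Q -> {set F}) :=
  [set V : Q -> {set F} | [/\ finite_set [set i | V i != finset.set0],
     (forall x : F, exists i, x \in V i),
     (forall i j, i != j -> V i :&: V j = finset.set0) &
     (forall i j, eta i < eta j ->
        forall x y : F, x \in V i -> y \in V j -> edge x y)]].
Arguments ordered_partitions {R Q} eta F.

Section IndDensityCvg.
Variable R : realType.

Lemma ind_count_hom_count (F G : tournament) : ind_count F G = hom_count F G.
Proof.
apply: eq_card => f; rewrite !inE.
have [irrF totF] := tournamentP F; have [irrG totG] := tournamentP G.
apply/andP/forallP => [[_ /forallP h] x|h].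
  by apply/forallP => y; have /forallP/(_ y)/eqP -> := h x; exact: implybb.
have homf x y : edge x y -> edge (f x) (f y).
  by have /forallP/(_ y)/implyP := h x.
have injf : injective f.
  move=> x y fxy; apply/eqP/negPn/negP => /totF.
  have [/homf|_ /homf] := boolP (edge x y); by rewrite fxy irrG.
split; first exact/injectiveP.
apply/forallP => x; apply/forallP => y; apply/eqP.
have [<-|xy] := eqVneq x y; first by rewrite irrF irrG.
have fxy : f x != f y by rewrite (inj_eq injf).
have := totF _ _ xy; have := totG _ _ fxy.
have [/homf ->//|_] := boolP (edge x y).
by move=> h1 /homf h2; move: h1; rewrite h2; case: (edge (f x) (f y)).
Qed.

Lemma ind_count_eq0 (F : digraph) (G : tournament) :
  ~ is_tournament F -> ind_count F G = 0%N.
Proof.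
move=> nF; apply/eqP/pred0P => f; apply/negbTE/negP; rewrite !inE.
case/andP=> /injectiveP injf /forallP h; apply: nF.
have ef x y : edge x y = edge (f x) (f y).
  by have /forallP/(_ y)/eqP := h x.
have [irrG totG] := tournamentP G; split=> [x|x y xy]; first by rewrite ef.
by rewrite !ef totG// (inj_eq injf).
Qed.

Lemma ffact_expn_cvg (u : nat -> nat) (k : nat) :
  ((u n)%:R : R) @[n --> \oo] --> +oo ->
  ((u n ^ k)%N%:R / (u n ^_ k)%N%:R : R) @[n --> \oo] --> (1 : R).
Proof.
move=> uoo; elim: k => [|k IH].
  under eq_fun do rewrite expn0 ffactn0 divr1; exact: cvg_cst.
rewrite -[X in _ --> X]mulr1.
have H : ((u n)%:R / (u n - k)%N%:R : R) @[n --> \oo] --> (1 : R).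
  have inv0 : ((u n)%:R^-1 : R) @[n --> \oo] --> (0 : R).
    apply/gtr0_cvgV0 => //.
    by move/cvgryPgt: uoo; exact.
  have : ((1 - k%:R * (u n)%:R^-1)^-1 : R) @[n --> \oo] --> ((1 - k%:R * 0)^-1 : R).
    apply: cvgV; first by rewrite mulr0 subr0 oner_neq0.
    apply: cvgB; first exact: cvg_cst.
    by apply: cvgM => //; exact: cvg_cst.
  rewrite mulr0 subr0 invr1; apply: cvg_trans; apply: near_eq_cvg.
  move/cvgryPgt: uoo => /(_ k%:R); apply: filterS => n; rewrite ltr_nat => kn.
  have un0 : (u n)%:R != 0 :> R by rewrite pnatr_eq0 -lt0n (leq_ltn_trans _ kn).
  rewrite natrB ?(ltnW kn)//.
  by rewrite -[X in (X - _)^-1](divff un0) -mulrBl invfM invrK mulrC.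
under eq_fun do rewrite expnSr ffactnSr !natrM invfM mulrACA.
exact: cvgM.
Qed.

Lemma ind_density_cvg_ex (F : digraph) (t : digraph -> R) :
  exists l : R, forall G, tournament_cvg G t ->
    ind_density R F (G n) @[n --> \oo] --> l.
Proof.
have [tF|nF] := pselect (is_tournament F); last first.
  exists 0 => G _; rewrite /ind_density.
  under eq_fun do rewrite ind_count_eq0// mul0r; exact: cvg_cst.
exists (t F) => G [Goo Gt].
rewrite -[t F]mulr1.
have : (hom_density R F (G n) *
   ((#|G n| ^ #|F|)%N%:R / (#|G n| ^_ #|F|)%N%:R)) @[n --> \oo] --> t F * 1.
  by apply: cvgM; [exact: Gt | exact: ffact_expn_cvg].
apply: cvg_trans; apply: near_eq_cvg.
move/cvgryPgt: Goo => /(_ 0); apply: filterS => n; rewrite ltr0n => Gn0.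
rewrite /ind_density /hom_density (ind_count_hom_count (Tournament tF)) /=.
by rewrite mulrA divfK// pnatr_eq0 -lt0n expn_gt0 Gn0.
Qed.

Lemma ind_density_cvg (F : digraph) (Gamma : tournament_limit R) G :
  tournament_cvg G Gamma ->
  ind_density R F (G n) @[n --> \oo] --> limit_ind_density F Gamma.
Proof.
move=> GG; have [l lP] := ind_density_cvg_ex F Gamma.
rewrite /limit_ind_density (cvg_lim _ (lP _ _)) //; first exact: lP.
by rewrite /limit_sequence; case: cid.
Qed.

End IndDensityCvg.

(* Main.v *)
Require Import Defs.
From HB Require Import structures.
From mathcomp Require Import all_boot all_order all_algebra.
From mathcomp Require Import finmap.
From mathcomp Require Import all_classical all_reals all_analysis.
From mathcomp Require Import ring lra.

Import Order.TTheory GRing.Theory Num.Theory.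
Import numFieldNormedType.Exports.

Local Open Scope classical_set_scope.
Local Open Scope ring_scope.

Set Implicit Arguments.
Unset Strict Implicit.
Unset Printing Implicit Defensive.

(* Uniqueness: up to a vanishing proportion of non-injective maps, a
   homomorphism from a digraph F to a large tournament is a homomorphism from
   exactly one tournament on V(F) containing F, so the densities of tournaments
   determine all densities.

   Existence: take finite sets I_n exhausting Q and, for i in I_n, a large
   tournament G close to Gamma_i. Replacing each vertex of G by a transitive
   tournament with b vertices changes the densities negligibly and adjusts the
   size to about alpha_i N. Let X_n be the sum of these blow-ups ordered by eta.
   Sorting the homomorphisms F -> X_n by the induced map c : F -> I_n, the
   number of those over c is a product over the classes of c, and vanishes
   unless the classes form an ordered partition. After division by N^v(F) the
   term of c is dominated by the product of the alpha_(c x), which is summable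
   over c, so the sum converges termwise. *)

(** * Homomorphisms into tournaments *)

Definition is_hom (F G : digraph) (f : F -> G) : bool :=
  [forall x, forall y, edge x y ==> edge (f x) (f y)].

Lemma is_homP (F G : digraph) (f : F -> G) :
  reflect (forall x y, edge x y -> edge (f x) (f y)) (is_hom f).
Proof.
apply: (iffP forallP) => [h x y|h x].
  by have /forallP/(_ y)/implyP := h x.
by apply/forallP => y; apply/implyP; exact: h.
Qed.

Lemma hom_countE (F G : digraph) :
  hom_count F G = #|[pred f : {ffun F -> G} | is_hom f]|.
Proof. by []. Qed.

(** Distinct vertices of [F] are joined by an edge, and if they had the same image that edge would
    map to a loop. *)
Lemma hom_tournament_inj (F G : tournament) (f : F -> G) :
  is_hom f -> injective f.
Proof.
move=> /is_homP homf x y fxy.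
have [_ totF] := tournamentP F; have [irrG _] := tournamentP G.
apply/eqP/negPn/negP => /totF.
have [/homf|_ /homf] := boolP (edge x y); by rewrite fxy irrG.
Qed.

Lemma card_noninj_ffuns (aT rT : finType) :
  #|[pred f : {ffun aT -> rT} | ~~ injectiveb f]| =
  (#|rT| ^ #|aT| - #|rT| ^_ #|aT|)%N.
Proof.
rewrite -card_ffun -card_inj_ffuns -(cardsC [set f : {ffun aT -> rT} | injectiveb f]).
by rewrite addKn; apply: eq_card => f; rewrite !inE.
Qed.

Lemma hom_count_le (F G : digraph) : (hom_count F G <= #|G| ^ #|F|)%N.
Proof. by rewrite -card_ffun; exact: max_card. Qed.

(** * Completions of a digraph to tournaments on the same vertices *)

Section Completion.
Variable F : digraph.

(** Edge relations are finite functions on pairs, so that completions range over a finite type and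
    can be summed over. *)
Definition rel_digraph (E : {ffun F * F -> bool}) : digraph :=
  @Digraph F (fun x y => E (x, y)).

Definition completes (E : {ffun F * F -> bool}) : bool :=
  `[< is_tournament (rel_digraph E) >] &&
  [forall x, forall y, edge x y ==> E (x, y)].

Lemma completes_tournament E : completes E -> is_tournament (rel_digraph E).
Proof. by case/andP => /asboolP. Qed.

(* An injective homomorphism into a tournament pulls back a tournament
   structure, so the injective homomorphisms are partitioned by completions. *)
Lemma sum_completions_hom_count (G : tournament) :
  (\sum_(E | completes E) hom_count (rel_digraph E) G =
   #|[pred f : {ffun F -> G} | is_hom f && injectiveb f]|)%N.
Proof.
pose pb (f : {ffun F -> G}) : {ffun F * F -> bool} :=
  [ffun p => edge (f p.1) (f p.2)].
have [irrG totG] := tournamentP G.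
rewrite -sum1_card (partition_big pb completes) /=; last first.
  move=> f /andP[/is_homP homf /injectiveP injf]; apply/andP; split.
    apply/asboolP; split=> [x|x y xy] /=; rewrite !ffunE /= ?irrG//.
    by rewrite totG// (inj_eq injf).
  apply/forallP => x; apply/forallP => y; apply/implyP => /homf.
  by rewrite ffunE.
apply: eq_bigr => E cE; rewrite hom_countE -sum1_card.
apply: eq_bigl => f; rewrite !inE.
have tE := completes_tournament cE.
apply/idP/andP => [homf|[/andP[homf /injectiveP injf] /eqP <-]].
  have injf : injective f by exact: (@hom_tournament_inj (Tournament tE) G f).
  case/andP: (cE) => _ /forallP FE.
  split; first (apply/andP; split; last exact/injectiveP).
    apply/is_homP => x y exy; have /is_homP := homf; apply => /=.
    by have /forallP/(_ y)/implyP := FE x; apply.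
  (* Edges of [E] map to edges of [G], and each of [E] and [G] has exactly one direction on a pair
     of distinct vertices, so [E] is the pullback. *)
  apply/eqP/ffunP => -[x y]; rewrite ffunE /=.
  have [irrE totE] := tE; have /is_homP homf' := homf.
  have [->|xy] := eqVneq x y; first by rewrite irrG; have := irrE y => /= ->.
  have := homf' x y; have := homf' y x; have := totE x y xy => /=.
  have := totG (f x) (f y); rewrite (inj_eq injf) xy => /(_ isT).
  case: (E (x, y)) => /=; case: (E (y, x)) => //=;
    case: (edge (f x) (f y)) => //=; case: (edge (f y) (f x)) => //= _ _ h1 h2.
    by have := h2 isT.
  by have := h1 isT.
by apply/is_homP => x y /=; rewrite ffunE.
Qed.

(** The completions count exactly the injective homomorphisms; the error term is the number of all
    non-injective maps. *)
Lemma hom_count_completions (G : tournament) :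
  (\sum_(E | completes E) hom_count (rel_digraph E) G <= hom_count F G <=
   \sum_(E | completes E) hom_count (rel_digraph E) G +
     (#|G| ^ #|F| - #|G| ^_ #|F|))%N.
Proof.
rewrite sum_completions_hom_count -card_noninj_ffuns hom_countE.
apply/andP; split.
  by apply/subset_leq_card/fintype.subsetP => f; rewrite !inE => /andP[].
set A := [pred f : {ffun F -> G} | is_hom f].
set B := [pred f : {ffun F -> G} | is_hom f && injectiveb f].
set C := [pred f : {ffun F -> G} | ~~ _].
apply: (@leq_trans #|[predU B & C]|); last by rewrite -cardUI leq_addr.
by apply/subset_leq_card/fintype.subsetP => f; rewrite !inE => ->; case: injectiveb.
Qed.

End Completion.

(** * Blow-ups of a tournament by transitive tournaments *)

Section Blowup.
Variables (G : tournament) (b : nat).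

Definition blowup_edge : rel (G * 'I_b)%type := fun u v =>
  if u.1 == v.1 then (u.2 < v.2)%N else edge u.1 v.1.

Lemma blowup_is_tournament : is_tournament (Digraph blowup_edge).
Proof.
have [irrG totG] := tournamentP G; rewrite /blowup_edge.
split=> [[u i]|[u i] [v j]] /=; first by rewrite eqxx ltnn.
rewrite -pair_eqE /pair_eq /= [v == u]eq_sym; have [_ /=|uv _] := eqVneq u v.
  by rewrite neq_ltn; case: ltngtP.
exact: totG.
Qed.

Definition blowup : tournament := Tournament blowup_is_tournament.

Lemma card_blowup : #|blowup| = (#|G| * b)%N.
Proof. by rewrite card_prod card_ord. Qed.

(** A map into the product is a pair of maps; [P] constrains only the first, and the second is
    free. *)
Lemma card_ffun_fst (T : finType) (P : pred {ffun T -> G}) :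
  #|[pred f : {ffun T -> G * 'I_b} | P [ffun x => (f x).1]]| =
  (#|[pred g | P g]| * b ^ #|T|)%N.
Proof.
rewrite -[in (b ^ _)%N](card_ord b) -card_ffun -[RHS]cardX.
pose h (f : {ffun T -> G * 'I_b}) :=
  ([ffun x => (f x).1] : {ffun T -> G}, [ffun x => (f x).2] : {ffun T -> 'I_b}).
pose h' (p : {ffun T -> G} * {ffun T -> 'I_b}) : {ffun T -> G * 'I_b} :=
  [ffun x => (p.1 x, p.2 x)].
have hK : cancel h h'.
  by move=> f; apply/ffunP => x; rewrite !ffunE /=; case: (f x).
have h'K : cancel h' h.
  by case=> g k; congr (_, _); apply/ffunP => x; rewrite !ffunE.
rewrite -(card_imset _ (can_inj hK)); apply: eq_card => p.
rewrite [RHS]inE /= andbT inE.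
apply/imsetP/idP => [[f]|Pp]; first by rewrite inE => ? ->.
exists (h' p); last by rewrite h'K.
by rewrite inE; have := congr1 fst (h'K p); rewrite /h /= => ->.
Qed.

(** Homomorphisms to [G] are injective, so all their lifts join different fibres and remain
    homomorphisms. Conversely, a homomorphism to the blow-up projects to a homomorphism unless its
    projection is non-injective. *)
Lemma hom_count_blowup (F : tournament) :
  (hom_count F G * b ^ #|F| <= hom_count F blowup <=
   (hom_count F G + (#|G| ^ #|F| - #|G| ^_ #|F|)) * b ^ #|F|)%N.
Proof.
have [irrF totF] := tournamentP F; have [irrG totG] := tournamentP G.
rewrite mulnDl -card_noninj_ffuns !hom_countE.
rewrite -(card_ffun_fst (fun f => is_hom f)) -(card_ffun_fst (fun f => ~~ injectiveb f)).
apply/andP; split.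
  apply/subset_leq_card/fintype.subsetP => f; rewrite !inE => homf.
  have injf := hom_tournament_inj homf; apply/is_homP => x y exy /=.
  rewrite /blowup_edge.
  have xy : x != y by apply: contraTneq exy => ->; rewrite irrF.
  have : [ffun x => (f x).1] x != [ffun x => (f x).1] y :> G by rewrite (inj_eq injf).
  rewrite !ffunE => /negPf ->.
  by move/is_homP : homf => /(_ x y exy); rewrite !ffunE.
set A := [pred f : {ffun F -> blowup} | is_hom f].
set B := [pred f : {ffun F -> G * 'I_b} | is_hom _].
set C := [pred f : {ffun F -> G * 'I_b} | ~~ _].
apply: (@leq_trans #|[predU B & C]|); last by rewrite -cardUI leq_addr.
apply/subset_leq_card/fintype.subsetP => f; rewrite /A /B /C !inE /= => /is_homP homf.
rewrite orbC -implybE; apply/implyP => /injectiveP injf.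
apply/is_homP => x y exy; have := homf x y exy.
have xy : x != y by apply: contraTneq exy => ->; rewrite irrF.
have : [ffun x => (f x).1] x != [ffun x => (f x).1] y :> G by rewrite (inj_eq injf).
by rewrite /= /blowup_edge !ffunE => /negPf ->.
Qed.

End Blowup.

(** * Ordered sums of tournaments and their homomorphism counts *)

Section LexSum.
Variables (R : realType) (I : finType) (e : I -> R) (e_inj : injective e).
Variable H : I -> tournament.

Definition lexsum_edge : rel {i : I & H i} := fun u v =>
  if tag u == tag v then edge (tagged u) (tagged_as u v)
  else e (tag u) < e (tag v).

Lemma lexsum_is_tournament : is_tournament (Digraph lexsum_edge).
Proof.
rewrite /lexsum_edge; split => [[i u]|[i u] [j v]] /=.
  rewrite eqxx (@tagged_asE _ _ (Tagged H u) u).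
  by have [irr _] := tournamentP (H i); exact: irr.
have [ij|ij _] := eqVneq i j; last first.
  by case: ltgtP (ij) => //= /e_inj ->; rewrite eqxx.
move: v; rewrite -{j}ij => v.
rewrite (@tagged_asE _ _ (Tagged H u) v) (@tagged_asE _ _ (Tagged H v) u).
rewrite eq_Tagged /= => uv.
by have [_ tot] := tournamentP (H i); exact: tot.
Qed.

Definition lexsum : tournament := Tournament lexsum_is_tournament.

Lemma card_lexsum : #|lexsum| = (\sum_i #|H i|)%N.
Proof. by rewrite card_tagged sumnE big_map big_enum. Qed.

Variable F : tournament.

Definition color_class (T : eqType) (c : {ffun F -> T}) (i : T) : {set F} :=
  [set x | c x == i].

Definition order_preserving (c : {ffun F -> I}) : bool :=
  [forall x, forall y, (e (c x) < e (c y)) ==> edge x y].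

(** Once the summand of each vertex is fixed by [c], edges between different classes impose no
    condition, so a homomorphism is an independent choice of one homomorphism per class. *)
Lemma card_hom_lexsum_colored (c : {ffun F -> I}) : order_preserving c ->
  #|[pred f : {ffun F -> lexsum} | is_hom f && ([ffun x => tag (f x)] == c)]| =
  (\prod_i hom_count (induced_tournament F (color_class c i)) (H i))%N.
Proof.
move=> /forallP ordc.
pose D i := induced_tournament F (color_class c i).
pose T := {dffun forall i, {ffun D i -> H i}}.
have cP x : x \in color_class c (c x) by rewrite inE.
(* [phi] glues a family of maps on the classes into one map on [F]. *)
pose phi (g : T) : {ffun F -> lexsum} :=
  [ffun x => Tagged H (g (c x) (Sub x (cP x) : D (c x)))].
have phiE (g : T) i (y : D i) : phi g (val y) = Tagged H (g i y).
  case: y => x xi; rewrite ffunE /=.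
  have cx : c x = i by move: xi; rewrite inE => /eqP.
  move: xi; rewrite -{i}cx => xi; congr (Tagged H (g _ _)); exact: val_inj.
have phi_inj : injective phi.
  move=> g g' gg'; apply/ffunP => i; apply/ffunP => y.
  have := congr1 (fun f : {ffun F -> lexsum} => f (val y)) gg'.
  by rewrite !phiE => /eqP; rewrite eq_Tagged => /eqP.
pose homs i := [pred g : {ffun D i -> H i} | is_hom g].
transitivity #|(family homs : simpl_pred T)|; last first.
  by rewrite card_family foldrE big_map big_enum.
rewrite -(card_imset _ phi_inj); apply: eq_card => f.
rewrite [LHS]inE; apply/andP/imsetP => [[/is_homP homf /eqP tagf]|[g gP ->]].
  have tagfE i (y : D i) : tag (f (val y)) = i.
    have /ffunP/(_ (val y)) := tagf; rewrite ffunE => ->.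
    by have := valP y; rewrite inE => /eqP.
  pose g : T := [ffun i => [ffun y : D i => etagged (tagfE i y)]].
  have fg : f = phi g.
    apply/ffunP => x; rewrite -[x in LHS]/(val (Sub x (cP x) : D (c x))) ffunE.
    by rewrite /= !ffunE etaggedK.
  exists g => //; apply/familyP => i; rewrite inE; apply/is_homP => y z eyz.
  have := homf (val y) (val z) eyz; rewrite fg !phiE /= /lexsum_edge /= eqxx.
  by rewrite (@tagged_asE _ _ (Tagged H (g i y)) (g i z)).
split; last by apply/eqP/ffunP => x; rewrite !ffunE.
move/familyP: gP => gP; apply/is_homP => x y exy.
have [cxy|cxy] := eqVneq (c x) (c y).
  have yP : y \in color_class c (c x) by rewrite inE cxy.
  have := phiE g (c x) (Sub x (cP x)); rewrite /= => ->.
  have := phiE g (c x) (Sub y yP); rewrite /= => ->.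
  rewrite /lexsum_edge /= eqxx (@tagged_asE _ _ (Tagged H (g (c x) _)) (g (c x) _)).
  by have /is_homP := gP (c x); apply.
rewrite /= /lexsum_edge !ffunE /= (negPf cxy).
(* Were the colours in the wrong order, [ordc] would give the reverse edge from [y] to [x]. *)
case: ltgtP cxy => // [cyx|/e_inj ->]; last by rewrite eqxx.
have /forallP/(_ x)/implyP/(_ cyx) eyx := ordc y => _.
have [irrF totF] := tournamentP F; have xy : x != y.
  by apply: contraTneq exy => ->; rewrite irrF.
by have := totF _ _ xy; rewrite exy eyx.
Qed.

Lemma hom_count_lexsum : hom_count F lexsum =
  (\sum_(c : {ffun F -> I} | order_preserving c)
     \prod_i hom_count (induced_tournament F (color_class c i)) (H i))%N.
Proof.
rewrite hom_countE -sum1_card.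
rewrite (partition_big (fun f : {ffun F -> lexsum} => [ffun x => tag (f x)])
  order_preserving) /=.
  by apply: eq_bigr => c oc; rewrite -card_hom_lexsum_colored// -sum1_card.
(* The colouring induced by a homomorphism preserves the order: an edge of [F] against the order
   would be sent to an edge of the sum against the order. *)
move=> f /is_homP homf; apply/forallP => x; apply/forallP => y.
rewrite !ffunE; apply/implyP => exy.
have [irrF totF] := tournamentP F; have xy : x != y.
  by apply: contraTneq exy => ->; rewrite ltxx.
have := totF _ _ xy; have [//|_ /= eyx] := boolP (edge x y).
have := homf _ _ eyx; rewrite /= /lexsum_edge; case: eqP => [yx|_].
  by move=> _; move: exy; rewrite yx ltxx.
by move=> /lt_trans/(_ exy); rewrite ltxx.
Qed.

End LexSum.

(** * Limits of densities: tournaments determine everything, and dominated sums *)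

Section Limits.
Variable R : realType.

Lemma cvgr_sum (I : Type) (r : seq I) (P : pred I) (f : I -> nat -> R)
    (l : I -> R) : (forall i, P i -> f i n @[n --> \oo] --> l i) ->
  \sum_(i <- r | P i) f i n @[n --> \oo] --> \sum_(i <- r | P i) l i.
Proof. by apply: cvg_big; exact: add_continuous. Qed.

Lemma cvgr_prod (I : Type) (r : seq I) (P : pred I) (f : I -> nat -> R)
    (l : I -> R) : (forall i, P i -> f i n @[n --> \oo] --> l i) ->
  \prod_(i <- r | P i) f i n @[n --> \oo] --> \prod_(i <- r | P i) l i.
Proof. by apply: cvg_big; exact: mul_continuous. Qed.

Lemma cvgr_exprn (f : nat -> R) (l : R) (k : nat) :
  f n @[n --> \oo] --> l -> f n ^+ k @[n --> \oo] --> l ^+ k.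
Proof.
move=> fl; rewrite -[k]card_ord -prodr_const.
by under eq_fun do rewrite -prodr_const; exact: cvgr_prod.
Qed.

Lemma ffact_leq_expn (n k : nat) : (n ^_ k <= n ^ k)%N.
Proof.
by elim: k => [|k IH]; rewrite ?ffactn0// ffactnSr expnSr leq_mul// leq_subr.
Qed.

Lemma ffact_div_expn_cvg (u : nat -> nat) (k : nat) :
  ((u n)%:R : R) @[n --> \oo] --> +oo ->
  ((u n ^_ k)%N%:R / (u n ^ k)%N%:R : R) @[n --> \oo] --> (1 : R).
Proof.
move=> /(@ffact_expn_cvg R u k) /(cvgV (oner_neq0 _)); rewrite invr1.
by apply: cvg_trans; apply: near_eq_cvg; apply: nearW => n /=; rewrite invf_div.
Qed.

Lemma hom_density_completions (F : digraph) (G : tournament) :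
  (0 < #|G|)%N ->
  \sum_(E : {ffun F * F -> bool} | completes E)
    hom_density R (rel_digraph E) G <= hom_density R F G <=
  \sum_(E : {ffun F * F -> bool} | completes E)
    hom_density R (rel_digraph E) G +
       (1 - (#|G| ^_ #|F|)%N%:R / (#|G| ^ #|F|)%N%:R).
Proof.
move=> G0; have D0 : 0 < (#|G| ^ #|F|)%N%:R :> R by rewrite ltr0n expn_gt0 G0.
rewrite /hom_density /= -mulr_suml -natr_sum.
rewrite -[X in _ + (X - _)](divff (lt0r_neq0 D0)) -mulrBl -mulrDl !ler_pM2r ?invr_gt0//.
rewrite -natrB ?ffact_leq_expn// -natrD !ler_nat.
exact: hom_count_completions.
Qed.

(** Squeeze: the proportion of non-injective maps tends to 0. Convergence thus need only be checked
    on tournaments. *)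
Lemma hom_density_cvg_completions (G : nat -> tournament) (s : digraph -> R) :
  ((#|G n|%:R : R) @[n --> \oo] --> +oo) ->
  (forall T : tournament, hom_density R T (G n) @[n --> \oo] --> s T) ->
  forall F, hom_density R F (G n) @[n --> \oo] -->
    \sum_(E : {ffun F * F -> bool} | completes E) s (rel_digraph E).
Proof.
move=> Goo Gs F.
have sumcvg : \sum_(E : {ffun F * F -> bool} | completes E)
    hom_density R (rel_digraph E) (G n) @[n --> \oo] -->
    \sum_(E : {ffun F * F -> bool} | completes E) s (rel_digraph E).
  apply: cvgr_sum => E cE.
  exact: (Gs (Tournament (completes_tournament cE))).
apply: (squeeze_cvgr _ sumcvg); last first.
  rewrite -[X in _ --> X]addr0 -[X in _ + X](subrr 1).
  apply: cvgD sumcvg _; apply: cvgB; first exact: cvg_cst.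
  exact: (ffact_div_expn_cvg #|F| Goo).
move/cvgryPgt: Goo => /(_ 0); apply: filterS => n; rewrite ltr0n.
exact: hom_density_completions.
Qed.

(** Between tournaments induced and homomorphism counts agree, and the two normalisations have ratio
    tending to 1. From here on only homomorphism densities are needed. *)
Lemma limit_ind_densityE (Gamma : tournament_limit R) (F : tournament) :
  limit_ind_density F Gamma = Gamma F.
Proof.
have [G GG] := limit_densityP Gamma.
have [Goo Gt] := GG.
have h1 := @ind_density_cvg R F Gamma G GG.
have h2 : hom_density R F (G n) @[n --> \oo] --> limit_ind_density F Gamma.
  have : (ind_density R F (G n) *
      ((#|G n| ^_ #|F|)%N%:R / (#|G n| ^ #|F|)%N%:R)) @[n --> \oo] -->
      limit_ind_density F Gamma * 1.
    by apply: cvgM; [exact: h1|exact: (ffact_div_expn_cvg #|F| Goo)].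
  rewrite mulr1.
  apply: cvg_trans; apply: near_eq_cvg.
  move/cvgryPgt: Goo => /(_ #|F|%:R); apply: filterS => n; rewrite ltr_nat => Gn.
  rewrite /ind_density /hom_density ind_count_hom_count /=.
  rewrite mulrA divfK// pnatr_eq0 -lt0n ffact_gt0; exact: ltnW.
by rewrite -(cvg_lim _ h2)// (cvg_lim _ (Gt F)).
Qed.

Lemma limit_density_completions (Gamma : tournament_limit R) (F : digraph) :
  Gamma F = \sum_(E : {ffun F * F -> bool} | completes E) Gamma (rel_digraph E).
Proof.
have [G [Goo Gt]] := limit_densityP Gamma.
have h : forall T : tournament, hom_density R T (G n) @[n --> \oo] --> Gamma T.
  by move=> T; exact: Gt.
by rewrite -(cvg_lim _ (hom_density_cvg_completions Goo h (F:=F)))// (cvg_lim _ (Gt F)).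
Qed.

Lemma tournament_limit_eq (Gamma Gamma' : tournament_limit R) :
  (forall T : tournament, Gamma T = Gamma' T) -> Gamma = Gamma'.
Proof.
move=> eqT.
have : Gamma = Gamma' :> (digraph -> R).
  apply/funext => F; rewrite 2!limit_density_completions.
  by apply: eq_bigr => E cE; exact: (eqT (Tournament (completes_tournament cE))).
case: Gamma Gamma' {eqT} => [t tP] [t' tP'] /= tt'.
by move: tP'; rewrite -tt' => tP'; congr TournamentLimit; exact: Prop_irrelevance.
Qed.

Lemma tournament_limit_of_cvg (G : nat -> tournament) (s : tournament -> R) :
  ((#|G n|%:R : R) @[n --> \oo] --> +oo) ->
  (forall T : tournament, hom_density R T (G n) @[n --> \oo] --> s T) ->
  exists Gamma : tournament_limit R, forall T : tournament, Gamma T = s T.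
Proof.
(* [s] takes bundled tournaments while [rel_digraph E] is a bare digraph, so [s] is replaced by a
   function of digraphs; only its values at tournaments are used. *)
move=> Goo Gs; pose l (F : digraph) := lim (hom_density R F (G n) @[n --> \oo]).
have Gl (T : tournament) : hom_density R T (G n) @[n --> \oo] --> l T.
  by rewrite /l (cvg_lim _ (Gs T)).
have GP : tournament_cvg G (fun F =>
    \sum_(E : {ffun F * F -> bool} | completes E) l (rel_digraph E)).
  by split=> // F; exact: hom_density_cvg_completions.
exists (TournamentLimit (ex_intro _ G GP)) => T.
by rewrite -(cvg_lim _ (Gs T))// (cvg_lim _ (GP.2 T)).
Qed.

(* Tannery's theorem. *)
Lemma esum_dominated_cvg (T : choiceType) (D : set T) (f : nat -> T -> R)
    (g b : T -> R) :
  (forall n t, D t -> 0 <= f n t <= b t) ->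
  (\esum_(t in D) (b t)%:E < +oo)%E ->
  (forall t, D t -> f n t @[n --> \oo] --> g t) ->
  \esum_(t in D) (g t)%:E \is a fin_num /\
  (fine (\esum_(t in D) (f n t)%:E) @[n --> \oo] -->
    fine (\esum_(t in D) (g t)%:E)).
Proof.
move=> fb boo fg.
have gb t : D t -> 0 <= g t <= b t.
  move=> Dt; apply/andP; split.
    rewrite -(cvg_lim _ (fg t Dt))//; apply: limr_ge.
      by apply/cvg_ex; exists (g t); exact: fg.
    by apply: nearW => n; have /andP[] := fb n t Dt.
  rewrite -(cvg_lim _ (fg t Dt))//; apply: limr_le.
    by apply/cvg_ex; exists (g t); exact: fg.
  by apply: nearW => n; have /andP[] := fb n t Dt.
have b0 t : D t -> 0 <= b t by move=> /gb /andP[]; exact: le_trans.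
have bfin : \esum_(t in D) (b t)%:E \is a fin_num.
  by rewrite ge0_fin_numE//; apply: esum_ge0 => t Dt; rewrite lee_fin b0.
split.
  rewrite ge0_fin_numE; last first.
    by apply: esum_ge0 => t /gb /andP[g0 _]; rewrite lee_fin.
  by apply: le_lt_trans boo; apply: le_esum => t /gb /andP[_]; rewrite lee_fin.
apply/cvgrPdist_le => e e0; have e20 : 0 < e / 2 by rewrite divr_gt0.
(* A finite [A] carries the sum of [b] up to [e / 2], so every family dominated by [b] has a tail in
   [[0, e / 2]] outside [A]. *)
have [_ [A [finA AD] <-] Ab] := ub_ereal_sup_adherent e20 bfin.
have tail (h : T -> R) : (forall t, D t -> 0 <= h t <= b t) ->
    0 <= fine (\esum_(t in D) (h t)%:E) - \sum_(t <- fset_set A) h t <= e / 2.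
  move=> hb.
  have split (k : T -> R) : (forall t, D t -> 0 <= k t) -> (\esum_(t in D) (k t)%:E =
      (\sum_(t <- fset_set A) k t)%:E + \esum_(t in D `&` ~` A) (k t)%:E)%E.
    move=> k0; rewrite (esumID A); last by move=> t Dt; rewrite lee_fin k0.
    congr (_ + _)%E; rewrite setIC setIidl//.
    rewrite esum_fset//; last by move=> t /set_mem /AD /k0; rewrite lee_fin.
    by rewrite fsbig_finite//= sumEFin.
  have h0 t : D t -> 0 <= h t by move=> /hb /andP[].
  have rest0 : (0 <= \esum_(t in D `&` ~` A) (h t)%:E)%E.
    by apply: esum_ge0 => t [Dt _]; rewrite lee_fin h0.
  have restb : (\esum_(t in D `&` ~` A) (h t)%:E <= (e / 2)%:E)%E.
    apply: (@le_trans _ _ (\esum_(t in D `&` ~` A) (b t)%:E)%E).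
      by apply: le_esum => t [Dt _]; rewrite lee_fin; have /andP[] := hb t Dt.
    move: Ab; rewrite -/(esum D (fun t => (b t)%:E)) (split _ b0).
    rewrite fsbig_finite//= sumEFin.
    case: (esum _ _) => [r||]//=; last by rewrite leNye.
    by rewrite lte_fin lee_fin => ?; lra.
  rewrite (split _ h0); move: rest0 restb.
  by case: (esum _ _) => [r||]//=; rewrite !lee_fin => ? ?; lra.
have : \sum_(t <- fset_set A) f n t @[n --> \oo] --> \sum_(t <- fset_set A) g t.
  rewrite big_seq; under eq_fun do rewrite big_seq.
  by apply: cvgr_sum => t; rewrite in_fset_set// => /set_mem/AD; exact: fg.
move/cvgrPdist_le => /(_ _ e20); apply: filterS => n.
(* Both tails lie in [[0, e / 2]], so they differ by at most [e / 2]; the finite sums account for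
   the other half. *)
have := tail _ gb; have := tail _ (fb n).
rewrite !ler_norml => /andP[? ?] /andP[? ?] /andP[? ?].
by apply/andP; split; lra.
Qed.

End Limits.

(** * Empty digraphs and subsequences of nonempty tournaments *)

Lemma hom_count_empty (F G : digraph) : #|F| = 0%N -> hom_count F G = 1%N.
Proof.
move=> F0; rewrite -(expn0 #|G|) -F0 -card_ffun; apply: eq_card => f.
by rewrite !inE; apply/forallP => x; have := card0_eq F0 x; rewrite inE.
Qed.

Lemma limit_density_empty (R : realType) (Gamma : tournament_limit R)
  (F : digraph) : #|F| = 0%N -> Gamma F = 1.
Proof.
move=> F0; have [G [_ /(_ F) Gt]] := limit_densityP Gamma.
rewrite -(cvg_lim _ Gt)// /hom_density F0.
under eq_fun do rewrite hom_count_empty// expn0 divr1.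
exact: lim_cst.
Qed.

Lemma card_induced (F : tournament) (A : {set F}) :
  #|induced_tournament F A| = #|A|.
Proof. by rewrite /= card_sig; apply: eq_card => x; rewrite inE. Qed.

(** Passing to a subsequence makes every term nonempty, so that one may divide by its order. *)
Lemma tournament_cvg_large (R : realType) (Gamma : tournament_limit R) :
  exists G : nat -> tournament, tournament_cvg G Gamma /\
    forall n, (n < #|G n|)%N.
Proof.
have [G [Goo Gt]] := limit_densityP Gamma.
have /choice[phi phiP] (n : nat) : exists m, (n <= m)%N && (n < #|G m|)%N.
  have [m _ mP] := (cvgryPgt _).1 Goo n%:R.
  exists (maxn m n); rewrite leq_maxr /=.
  by have := mP (maxn m n); rewrite /= leq_maxl ltr_nat => /(_ isT).
have phioo : phi n @[n --> \oo] --> \oo.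
  apply/cvgnyPge => A; exists A => //= n An.
  by have /andP[+ _] := phiP n; exact: leq_trans.
exists (G \o phi); split; last by move=> n; have /andP[] := phiP n.
split=> [|F]; first exact: (cvg_comp _ _ phioo Goo).
exact: (cvg_comp _ _ phioo (Gt F)).
Qed.

(** * Blow-ups approximating the limits with prescribed relative sizes *)

Section Parts.
Variables (R : realType) (Q : countType) (Gamma_ : Q -> tournament_limit R).
Variable alpha : Q -> R.
Hypothesis alpha_gt0 : forall i : Q, 0 < alpha i.
Hypothesis alpha_sum1 : \esum_(i in [set: Q]) (alpha i)%:E = 1%:E.

Lemma sum_alpha_le1 (A : {fset Q}) : \sum_(i <- A) alpha i <= 1.
Proof.
rewrite -lee_fin -alpha_sum1; apply: esum_ge; exists [set` A].
  by split=> //; exact: finite_fset.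
by rewrite -fsbig_seq// sumEFin.
Qed.

Lemma sum_alpha_gt (e : R) : 0 < e ->
  exists A : {fset Q}, 1 - e < \sum_(i <- A) alpha i.
Proof.
move=> e0.
have fin1 : \esum_(i in [set: Q]) (alpha i)%:E \is a fin_num by rewrite alpha_sum1.
have [_ [A [finA _] <-]] := ub_ereal_sup_adherent e0 fin1.
rewrite -/(esum _ _) alpha_sum1 fsbig_finite//= sumEFin lte_fin.
by exists (fset_set A).
Qed.

(** Otherwise adding [i] to [A] would push the sum above 1. *)
Lemma alpha_mem (A : {fset Q}) (i : Q) (e : R) : e <= alpha i ->
  1 - e < \sum_(i <- A) alpha i -> i \in A.
Proof.
move=> ei hA; apply: contraT => iA; have := sum_alpha_le1 (i |` A)%fset.
by rewrite big_fsetU1//= => ?; exfalso; lra.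
Qed.

Lemma approximating_parts :
  exists (I : nat -> {fset Q}) (H : nat -> Q -> tournament) (N : nat -> nat),
  [/\ ((N n)%:R : R) @[n --> \oo] --> +oo,
      forall n, (0 < N n)%N /\ forall i, #|H n i|%:R <= alpha i * (N n)%:R,
      forall i, \forall n \near \oo, i \in I n,
      (\sum_(i <- I n) #|H n i|)%N%:R / (N n)%:R @[n --> \oo] --> (1 : R) &
      forall i (F : tournament),
        (hom_count F (H n i))%:R / (N n)%:R ^+ #|F| @[n --> \oo] -->
        alpha i ^+ #|F| * Gamma_ i F].
Proof.
have /choice[G GP] i := tournament_cvg_large (Gamma_ i).
have /choice[I IP] (n : nat) : exists A : {fset Q},
    1 - n.+1%:R^-1 < \sum_(i <- A) alpha i.
  by apply: sum_alpha_gt; rewrite invr_gt0.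
have G0 i n : (0 < #|G i n|)%N by have [_ /(_ n)] := GP i; apply: leq_ltn_trans.
have G0R i n : 0 < #|G i n|%:R :> R by rewrite ltr0n.
pose V n := (\sum_(i <- I n) #|G i n|)%N.
(* [I n] is nonempty even for [n = 0], since its weight strictly exceeds [1 - n.+1%:R^-1], which is
   nonnegative. *)
have V0 n : (0 < V n)%N.
  rewrite lt0n sum_nat_seq_neq0; apply/hasP.
  have [I0|[i iI]] := fset_0Vmem (I n); last first.
    by exists i; rewrite ?andTb -?lt0n.
  have := IP n; rewrite I0 big_seq_fset0 subr_lt0 invf_gt1// ?ltr0n//.
  by rewrite ltNge ler1n.
(* Rounding costs at most [#|G i n|] vertices in part [i], hence at most [V n] in total; this [N]
   makes that a fraction [n.+1%:R^-1]. *)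
pose N n := (n.+1 * V n)%N.
have N0 n : 0 < (N n)%:R :> R by rewrite ltr0n muln_gt0 V0.
pose b n i := Num.truncn (alpha i * (N n)%:R / #|G i n|%:R).
pose H n i := blowup (G i n) (b n i).
have cH n i : #|H n i|%:R = #|G i n|%:R * (b n i)%:R :> R.
  by rewrite card_blowup natrM.
have bP n i : (b n i)%:R <= alpha i * (N n)%:R / #|G i n|%:R < (b n i)%:R + 1.
  rewrite natr1; apply: truncn_itv.
  by rewrite divr_ge0// mulr_ge0// ltW// alpha_gt0.
have H_le n i : #|H n i|%:R <= alpha i * (N n)%:R.
  by rewrite cH mulrC -ler_pdivlMr//; have /andP[] := bP n i.
have H_ge n i : alpha i * (N n)%:R - #|G i n|%:R <= #|H n i|%:R.
  have /andP[_] := bP n i; rewrite ltr_pdivrMr// mulrDl mul1r => h.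
  by rewrite cH [X in _ <= X]mulrC lerBlDr ltW.
have VN n : (V n)%:R / (N n)%:R = n.+1%:R^-1 :> R.
  rewrite /N natrM invfM mulrCA divff ?mulr1//.
  by rewrite pnatr_eq0 -lt0n.
have invn0 : (n.+1%:R^-1 : R) @[n --> \oo] --> (0 : R) by exact: cvg_harmonic.
have memI i : \forall n \near \oo, i \in I n.
  have /cvgrPdist_le/(_ _ (alpha_gt0 i)) := invn0.
  apply: filterS => n; rewrite sub0r normrN ger0_norm ?invr_ge0//.
  by move/alpha_mem; apply.
exists I, H, N; split => //.
- apply/cvgryPge => A; have /cvgryPge/(_ A) := @cvgr_idn R.
  apply: filterS => n /le_trans; apply; rewrite ler_nat.
  by rewrite (leq_trans (leqnSn n))// leq_pmulr.
- by move=> n; split=> //; rewrite -(ltr0n R).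
(* One error term is the weight missing outside [I n], the other the total rounding loss. *)
- have lo : 1 - n.+1%:R^-1 - n.+1%:R^-1 @[n --> \oo] --> (1 : R).
    rewrite -[X in _ --> X]subr0 -[X in _ --> X]subr0.
    by apply: cvgB => //; apply: cvgB => //; exact: cvg_cst.
  apply: (squeeze_cvgr _ lo (h := fun=> 1)); last exact: cvg_cst.
  apply: nearW => n; rewrite natr_sum; apply/andP; split.
    rewrite ler_pdivlMr//.
    apply: (@le_trans _ _ (\sum_(i <- I n) (alpha i * (N n)%:R - #|G i n|%:R))).
      rewrite big_split /= -mulr_suml sumrN -natr_sum -/(V n) mulrBl -VN.
      rewrite divfK ?lt0r_neq0// lerB// ler_wpM2r ?ltW//.
      by rewrite VN.
    by apply: ler_sum => i _; exact: H_ge.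
  rewrite ler_pdivrMr// mul1r.
  apply: (@le_trans _ _ (\sum_(i <- I n) (alpha i * (N n)%:R))).
    by apply: ler_sum => i _; exact: H_le.
  by rewrite -mulr_suml; apply: ler_piMl; [exact: ltW|exact: sum_alpha_le1].
- move=> i F.
  have HN : #|H n i|%:R / (N n)%:R @[n --> \oo] --> alpha i.
    have lo : alpha i - n.+1%:R^-1 @[n --> \oo] --> alpha i.
      rewrite -[X in _ --> X]subr0.
      by apply: cvgB => //; exact: cvg_cst.
    apply: (squeeze_cvgr _ lo (h := fun=> alpha i)); last exact: cvg_cst.
    (* Once [i] is in [I n], [#|G i n|] is a summand of [V n], which bounds the rounding loss of
       this part. *)
    have := memI i; apply: filterS => n iI; apply/andP; split; last first.
      by rewrite ler_pdivrMr.
    rewrite ler_pdivlMr//; apply: le_trans (H_ge n i).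
    rewrite mulrBl -VN divfK ?lt0r_neq0// lerB// ler_nat.
    by rewrite /V (big_rem i)//= leq_addr.
  have [[Goo Gt] _] := GP i.
  have HNk := cvgr_exprn (k := #|F|) HN.
  have lo : (#|H n i|%:R / (N n)%:R) ^+ #|F| * hom_density R F (G i n)
      @[n --> \oo] --> alpha i ^+ #|F| * Gamma_ i F.
    by apply: cvgM HNk _; exact: Gt.
  have hi : (#|H n i|%:R / (N n)%:R) ^+ #|F| * (hom_density R F (G i n) +
      (1 - (#|G i n| ^_ #|F|)%N%:R / (#|G i n| ^ #|F|)%N%:R)) @[n --> \oo] -->
      alpha i ^+ #|F| * Gamma_ i F.
    apply: cvgM HNk _; rewrite -[X in _ --> X]addr0 -[X in _ + X](subrr 1).
    apply: cvgD (Gt F) _; apply: cvgB; first exact: cvg_cst.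
    exact: (ffact_div_expn_cvg #|F| Goo).
  apply: (squeeze_cvgr _ lo hi); apply: nearW => n /=.
  have D0 : 0 < (#|G i n| ^ #|F|)%N%:R :> R by rewrite ltr0n expn_gt0 G0.
  have NF0 : 0 < (N n)%:R ^+ #|F| :> R by rewrite exprn_gt0.
  rewrite -[X in _ + (X - _)](divff (lt0r_neq0 D0)) /hom_density -mulrBl -mulrDl.
  (* Rewrites both bounds as counts over [(N n)%:R ^+ #|F|], the form in which [hom_count_blowup]
     applies. *)
  have E (x : R) : (#|H n i|%:R / (N n)%:R) ^+ #|F| *
      (x / (#|G i n| ^ #|F|)%N%:R) =
      x * (b n i ^ #|F|)%N%:R / (N n)%:R ^+ #|F|.
    rewrite cH expr_div_n exprMn -!natrX in NF0 D0 *.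
    by field; rewrite !lt0r_neq0.
  have /andP[h1 h2] := hom_count_blowup (G i n) (b n i) F.
  rewrite -natrB ?ffact_leq_expn// -natrD.
  by rewrite !E !ler_pM2r ?invr_gt0// -!natrM !ler_nat h1 h2.
Qed.

End Parts.

(** * Colourings of the vertices by a countable set *)

Section Colorings.
Variables (R : realType) (Q : countType) (F : tournament).
Implicit Types (c : {ffun F -> Q}) (A : {fset Q}).

Lemma color_class_notin c A i :
  (forall x, c x \in A) -> i \notin A -> color_class c i = finset.set0.
Proof.
move=> cA iA; apply/setP => x; rewrite !inE; apply/negP => /eqP cx.
by move: iA; rewrite -cx cA.
Qed.

(** Colours outside [A] have empty classes, which contribute the factor 1. *)
Lemma fsprod_color_class c A (w : {set F} -> Q -> R) :
  (forall i, w finset.set0 i = 1) -> (forall x, c x \in A) ->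
  \big[*%R/1]_(i \in [set: Q]) w (color_class c i) i =
  \prod_(i <- A) w (color_class c i) i.
Proof.
move=> w0 cA; apply: fsbigTE => i iA.
by rewrite (color_class_notin cA iA).
Qed.

Lemma prod_color_class_exp c A (a : Q -> R) : (forall x, c x \in A) ->
  \prod_(i <- A) a i ^+ #|color_class c i| = \prod_x a (c x).
Proof.
move=> cA.
transitivity (\prod_(i <- A) \prod_(x | c x == i) a i).
  apply: eq_bigr => i _; rewrite prodr_const; congr (_ ^+ _).
  by apply: eq_card => x; rewrite !inE.
rewrite (exchange_big_dep xpredT)//=; apply: eq_bigr => x _.
rewrite -big_filter (_ : [seq i <- A | c x == i] = [:: c x]) ?big_seq1//.
rewrite -(@filter_pred1_uniq _ A (c x)) ?fset_uniq//.
by apply: eq_filter => i /=; rewrite eq_sym.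
Qed.

Definition lift_coloring A (c : {ffun F -> A}) : {ffun F -> Q} :=
  [ffun x => val (c x)].

Lemma lift_coloring_inj A : injective (@lift_coloring A).
Proof.
move=> c c' cc'; apply/ffunP => x; apply: val_inj.
by have := congr1 (fun f : {ffun F -> Q} => f x) cc'; rewrite !ffunE.
Qed.

Lemma esum_colorings A (a : {ffun F -> Q} -> R) : (forall c, 0 <= a c) ->
  \esum_(c in [set c : {ffun F -> Q} | forall x, c x \in A]) (a c)%:E =
  (\sum_(c : {ffun F -> A}) a (lift_coloring c))%:E.
Proof.
move=> a0.
have -> : [set c : {ffun F -> Q} | forall x, c x \in A] =
    @lift_coloring A @` [set: {ffun F -> A}].
  apply/seteqP; split => [c /= cA|_ [c _ <-] x]; last first.
    by rewrite ffunE; exact: valP.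
  by exists [ffun x => [` cA x]%fset] => //; apply/ffunP => x; rewrite !ffunE.
rewrite esum_image; last by move=> c c' _ _; exact: lift_coloring_inj.
have finT : finite_set [set: {ffun F -> A}].
  apply: sub_finite_set (finite_seq (index_enum {ffun F -> A})) => c _ /=.
  by rewrite mem_index_enum.
rewrite esum_fset//; last by move=> c _; rewrite lee_fin.
rewrite (fsbigE (index_enum {ffun F -> A})) ?index_enum_uniq//; last first.
  by move=> c _; rewrite mem_index_enum.
by rewrite sumEFin; congr EFin; apply: eq_bigl => c; rewrite in_setT.
Qed.

(** Finitely many colourings use finitely many colours, and over a finite colour set the sum expands
    the power [#|F|] of a partial sum of [alpha], which is at most 1. *)
Lemma prod_alpha_summable (alpha : Q -> R) (D : set {ffun F -> Q}) :
  (forall i : Q, 0 < alpha i) ->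
  \esum_(i in [set: Q]) (alpha i)%:E = 1%:E ->
  (\esum_(c in D) (\prod_x alpha (c x))%:E < +oo)%E.
Proof.
move=> alpha_gt0 alpha_sum1; apply: (@le_lt_trans _ _ 1%E); last exact: ltry.
apply: ge_ereal_sup => _ [X [finX _] <-].
have [A AP] : exists A : {fset Q}, forall c, X c -> forall x, c x \in A.
  exists (seq_fset tt (flatten [seq codom c | c <- fset_set X])) => c Xc x.
  rewrite seq_fsetE; apply/flattenP; exists (codom c); last exact: codom_f.
  by apply: map_f; rewrite in_fset_set// mem_set.
have p0 (c : {ffun F -> Q}) : 0 <= \prod_x alpha (c x).
  by apply: prodr_ge0 => x _; exact: ltW.
apply: (@le_trans _ _ (\esum_(c in [set c : {ffun F -> Q} | forall x, c x \in A])
    (\prod_x alpha (c x))%:E)%E).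
  by apply: ereal_sup_ubound; exists X.
rewrite esum_colorings// lee_fin.
have -> : \sum_(c : {ffun F -> A}) \prod_x alpha (lift_coloring c x) =
    (\sum_(i <- A) alpha i) ^+ #|F|.
  rewrite (big_seq_fsetE _ _ xpredT) /= -prodr_const bigA_distr_bigA /=.
  by apply: eq_bigr => c _; apply: eq_bigr => x _; rewrite ffunE.
rewrite exprn_ile1//; last exact: (sum_alpha_le1 alpha_sum1).
by apply: sumr_ge0 => i _; exact: ltW.
Qed.

End Colorings.

(** Colourings encode ordered partitions: covering, disjointness and finiteness hold automatically
    for the classes of a function on [F]. *)
Definition ordered_colorings (R : realType) (Q : countType) (eta : Q -> R)
    (F : tournament) : set {ffun F -> Q} :=
  [set c : {ffun F -> Q} | forall x y, eta (c x) < eta (c y) -> edge x y].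
Arguments ordered_colorings {R Q} eta F _ /.

(** * Ordered sums of the approximating parts and their limit densities *)

Section Composition.
Variables (R : realType) (Q : countType) (eta : Q -> R).
Hypothesis eta_inj : injective eta.
Variables (Gamma_ : Q -> tournament_limit R) (alpha : Q -> R).
Hypothesis alpha_gt0 : forall i : Q, 0 < alpha i.
Hypothesis alpha_sum1 : \esum_(i in [set: Q]) (alpha i)%:E = 1%:E.

Lemma ordered_partitions_bij (F : tournament) :
  set_bij (ordered_colorings eta F) (ordered_partitions eta F)
    (fun c => color_class c).
Proof.
split.
- move=> c /= oc; split.
  + apply: (@sub_finite_set _ _ [set` codom c]); last exact: finite_seq.
    move=> i /= /set0Pn[x]; rewrite inE => /eqP <-; exact: codom_f.
  + by move=> x; exists (c x); rewrite inE.
  + move=> i j ij; apply/setP => x; rewrite !inE; apply/negP => /andP[/eqP xi].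
    by rewrite xi (negPf ij).
  + by move=> i j ij x y; rewrite !inE => /eqP xi /eqP yj; apply: oc; rewrite xi yj.
- move=> c c' _ _ cc'; apply/ffunP => x.
  have := congr1 (fun V : Q -> {set F} => x \in V (c x)) cc'.
  by rewrite !inE eqxx => /esym/eqP.
- move=> V [_ Vcov Vdis Vord].
  have /choice[c cV] := Vcov.
  have VE i x : (x \in V i) = (c x == i).
    apply/idP/eqP => [xi|<-]; last exact: cV.
    apply/eqP; apply: contraT => cxi.
    by have /setP/(_ x) := Vdis _ _ cxi; rewrite !inE xi cV.
  exists [ffun x => c x].
    by move=> x y; rewrite !ffunE => /Vord; apply; exact: cV.
  by apply/funext => i; apply/setP => x; rewrite inE ffunE VE.
Qed.

Definition composition_term (F : tournament) (c : {ffun F -> Q}) : R :=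
  \big[*%R/1]_(i \in [set: Q]) (alpha i ^+ #|color_class c i| *
     Gamma_ i (induced_tournament F (color_class c i))).

Section Approximation.
Variables (I : nat -> {fset Q}) (H : nat -> Q -> tournament) (N : nat -> nat).
Hypothesis N_oo : ((N n)%:R : R) @[n --> \oo] --> +oo.
Hypothesis N_gt0 : forall n, (0 < N n)%N.
Hypothesis H_le : forall n i, #|H n i|%:R <= alpha i * (N n)%:R.
Hypothesis I_mem : forall i, \forall n \near \oo, i \in I n.
Hypothesis H_sum :
  (\sum_(i <- I n) #|H n i|)%N%:R / (N n)%:R @[n --> \oo] --> (1 : R).
Hypothesis H_cvg : forall i (F : tournament),
  (hom_count F (H n i))%:R / (N n)%:R ^+ #|F| @[n --> \oo] -->
  alpha i ^+ #|F| * Gamma_ i F.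

Let eta_val_inj n : injective (fun i : I n => eta (val i)).
Proof. by move=> i j /eta_inj/val_inj. Qed.

Definition composition n : tournament :=
  lexsum (@eta_val_inj n) (fun i : I n => H n (val i)).

Lemma card_composition n : #|composition n| = (\sum_(i <- I n) #|H n i|)%N.
Proof. by rewrite card_lexsum -(big_seq_fsetE _ _ xpredT (fun i => #|H n i|)). Qed.

Lemma card_composition_cvg : (#|composition n|%:R : R) @[n --> \oo] --> +oo.
Proof.
apply/cvgryPge => A.
have /cvgryPge/(_ (2 * A)) N2A := N_oo.
(* The order of the composition is eventually at least half of [N n]. *)
have half1 : 2^-1 < 1 :> R by rewrite invf_lt1// ltr1n.
apply: filterS2 N2A (cvgr_ge _ H_sum _ half1) => n h1.
by rewrite card_composition ler_pdivlMr ?ltr0n// => ?; lra.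
Qed.

Variable F : tournament.

Definition part_weight n (A : {set F}) (i : Q) : R :=
  (hom_count (induced_tournament F A) (H n i))%:R / (N n)%:R ^+ #|A|.

(** Extending by 0 outside the colours of [I n] gives all [n] the same index set, as termwise
    convergence requires. *)
Definition approx_term n (c : {ffun F -> Q}) : R :=
  if c \in [set c : {ffun F -> Q} | forall x, c x \in I n]
  then \big[*%R/1]_(i \in [set: Q]) part_weight n (color_class c i) i else 0.

Lemma part_weight0 n i : part_weight n finset.set0 i = 1.
Proof.
by rewrite /part_weight cards0 hom_count_empty ?divr1// card_induced cards0.
Qed.

Lemma part_weight_ge0 n A i : 0 <= part_weight n A i.
Proof. by rewrite divr_ge0// exprn_ge0. Qed.

(** Bounds homomorphisms by all maps; multiplied over the classes this gives a bound independent of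
    [n]. *)
Lemma part_weight_le n A i : part_weight n A i <= alpha i ^+ #|A|.
Proof.
rewrite ler_pdivrMr ?exprn_gt0 ?ltr0n// -exprMn.
apply: (@le_trans _ _ (#|H n i|%:R ^+ #|A|)).
  by rewrite -natrX ler_nat -[#|A|]card_induced hom_count_le.
by rewrite lerXn2r// ?nnegrE// mulr_ge0// ltW.
Qed.

Lemma hom_count_composition n :
  ((hom_count F (composition n))%:R / (N n)%:R ^+ #|F|)%:E =
  \esum_(c in ordered_colorings eta F) (approx_term n c)%:E.
Proof.
pose J := [set c : {ffun F -> Q} | forall x, c x \in I n].
pose a (c : {ffun F -> Q}) : R :=
  \big[*%R/1]_(i \in [set: Q]) part_weight n (color_class c i) i.
transitivity (\esum_(c in ordered_colorings eta F) if c \in J then (a c)%:E else 0%E).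
  (* The two conditions trade places: the sum now runs over [J], where it is finite, with
     orderedness as the indicator. *)
  rewrite -esum_mkcondr esum_mkcondl.
  transitivity (\esum_(c in J) (if c \in ordered_colorings eta F then a c else 0)%:E).
    rewrite esum_colorings; last first.
      move=> c; case: ifP => // _.
      by apply: prodr_ge0 => i _; exact: part_weight_ge0.
    congr EFin; rewrite hom_count_lexsum natr_sum mulr_suml.
    rewrite [RHS](eq_bigr (fun c : {ffun F -> I n} =>
      if order_preserving (fun i : I n => eta (val i)) c
      then a (lift_coloring c) else 0)).
      rewrite -big_mkcond; apply: eq_bigr => c _.
      have cI x : lift_coloring c x \in I n by rewrite ffunE; exact: valP.
      rewrite /a (fsprod_color_class (part_weight0 n) cI).
      rewrite big_split /= prodfV.
      rewrite (prod_color_class_exp (fun=> (N n)%:R) cI) prodr_const.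
      congr (_ / _); rewrite natr_prod (big_seq_fsetE _ _ xpredT) /=.
      apply: eq_bigr => i _; congr (hom_count (induced_tournament F _) _)%:R.
      by apply/setP => x; rewrite !inE ffunE.
    move=> c _; congr (if _ then _ else _).
    apply/idP/forallP => [/set_mem oc x|oc].
      by apply/forallP => y; apply/implyP => h; apply: oc; rewrite !ffunE.
    apply/mem_set => x y; rewrite !ffunE.
    by have /forallP/(_ y)/implyP := oc x.
  by apply: eq_esum => c _; case: ifP.
by apply: eq_esum => c _; rewrite /approx_term -/J -/a; case: ifP.
Qed.

Lemma approx_term_bound n c :
  0 <= approx_term n c <= \prod_x alpha (c x).
Proof.
rewrite /approx_term; case: ifPn => [/set_mem cI|_]; last first.
  by rewrite lexx /=; apply: prodr_ge0 => x _; exact: ltW.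
rewrite (fsprod_color_class (part_weight0 n) cI).
rewrite -(prod_color_class_exp alpha cI); apply/andP; split.
  by apply: prodr_ge0 => i _; exact: part_weight_ge0.
by apply: ler_prod => i _; rewrite part_weight_ge0 part_weight_le.
Qed.

Lemma approx_term_cvg c :
  approx_term n c @[n --> \oo] --> composition_term c.
Proof.
(* The colours used by [c] give a finite product whose index set does not depend on [n]. *)
pose A : {fset Q} := seq_fset tt (codom c).
have cA x : c x \in A by rewrite seq_fsetE codom_f.
have w0 i : alpha i ^+ #|(finset.set0 : {set F})| *
    Gamma_ i (induced_tournament F finset.set0) = 1.
  by rewrite cards0 mul1r limit_density_empty// card_induced cards0.
rewrite /composition_term (fsprod_color_class (w := fun A i =>
  alpha i ^+ #|A| * Gamma_ i (induced_tournament F A)) w0 cA).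
have : \prod_(i <- A) part_weight n (color_class c i) i @[n --> \oo] -->
    \prod_(i <- A) (alpha i ^+ #|color_class c i| *
      Gamma_ i (induced_tournament F (color_class c i))).
  apply: cvgr_prod => i _.
  by have := H_cvg (i := i) (F := induced_tournament F (color_class c i));
    rewrite card_induced.
apply: cvg_trans; apply: near_eq_cvg.
have : \forall n \near \oo, forall x, c x \in I n.
  by apply: filter_forall => x; exact: I_mem.
apply: filterS => n cI; rewrite /approx_term mem_set//.
rewrite -(fsprod_color_class (part_weight0 n) cA).
by [].
Qed.

(** Dominated convergence gives the limit of the counts normalised by [N n]; replacing [N n] by the
    true order costs a factor tending to 1. *)
Lemma composition_density_cvg :
  \esum_(c in ordered_colorings eta F) (composition_term c)%:E \is a fin_num /\
  (hom_density R F (composition n) @[n --> \oo] -->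
    fine (\esum_(c in ordered_colorings eta F) (composition_term c)%:E)).
Proof.
have [sfin scvg] := @esum_dominated_cvg R _ (ordered_colorings eta F)
  approx_term (@composition_term F) (fun c => \prod_x alpha (c x))
  (fun n c _ => approx_term_bound n c)
  (prod_alpha_summable _ alpha_gt0 alpha_sum1)
  (fun c _ => @approx_term_cvg c).
split=> //.
have Mcvg : ((#|composition n|%:R / (N n)%:R) ^+ #|F|)^-1 @[n --> \oo] --> (1 : R).
  rewrite -[X in _ --> X]invr1; apply: cvgV; first exact: oner_neq0.
  rewrite -[X in _ --> X](expr1n _ #|F|); apply: cvgr_exprn.
  by under eq_fun do rewrite card_composition.
have : fine (\esum_(c in ordered_colorings eta F) (approx_term n c)%:E) *
    ((#|composition n|%:R / (N n)%:R) ^+ #|F|)^-1 @[n --> \oo] -->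
    fine (\esum_(c in ordered_colorings eta F) (composition_term c)%:E) * 1.
  exact: cvgM.
rewrite mulr1; apply: cvg_trans; apply: near_eq_cvg; apply: nearW => n.
rewrite -hom_count_composition [fine _]/= /hom_density natrX expr_div_n invf_div.
by rewrite mulrA divfK// expf_neq0// pnatr_eq0 -lt0n.
Qed.

End Approximation.

Lemma esum_ordered_partitions (F : tournament) :
  \esum_(V in ordered_partitions eta F)
      (\big[*%R/1]_(i \in [set: Q])
         (alpha i ^+ #|V i| *
          limit_ind_density (induced_tournament F (V i)) (Gamma_ i)))%:E =
  \esum_(c in ordered_colorings eta F) (composition_term c)%:E.
Proof.
rewrite (reindex_esum _ _ (fun c : {ffun F -> Q} => color_class c) _
  (ordered_partitions_bij F)).
apply: eq_esum => c _; congr EFin; apply: eq_fsbigr => i _.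
by rewrite limit_ind_densityE.
Qed.

End Composition.

Theorem theorem7p1 (R : realType) (Q : countType) (eta : Q -> R)
    (eta01 : forall i : Q, 0 <= eta i <= 1) (eta_inj : injective eta)
    (Gamma_ : Q -> tournament_limit R) (alpha : Q -> R)
    (alpha_gt0 : forall i : Q, 0 < alpha i)
    (alpha_sum1 : \esum_(i in [set: Q]) (alpha i)%:E = 1%:E) :
  exists! Gamma : tournament_limit R, forall F : tournament,
    (limit_ind_density F Gamma)%:E =
    \esum_(V in ordered_partitions eta F)
      (\big[*%R/1]_(i \in [set: Q])
         (alpha i ^+ #|V i| *
          limit_ind_density (induced_tournament F (V i)) (Gamma_ i)))%:E.
Proof.
have [I [H [N [Noo NP I_mem H_sum H_cvg]]]] :=
  approximating_parts Gamma_ alpha_gt0 alpha_sum1.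
have N_gt0 n : (0 < N n)%N by have [] := NP n.
have H_le n i : #|H n i|%:R <= alpha i * (N n)%:R by have [_] := NP n.
have cvgX := composition_density_cvg eta_inj alpha_gt0 alpha_sum1
  N_gt0 H_le I_mem H_sum H_cvg.
pose X := composition eta_inj I H.
have Xoo : (#|X n|%:R : R) @[n --> \oo] --> +oo.
  exact: (@card_composition_cvg _ _ _ eta_inj _ _ _ Noo N_gt0 H_sum).
have [Gamma GammaE] := tournament_limit_of_cvg Xoo (fun T => (cvgX T).2).
exists Gamma; split=> [F|Gamma' Gamma'P].
  rewrite limit_ind_densityE GammaE esum_ordered_partitions fineK//.
  by have [] := cvgX F.
(* The formula prescribes the value at every tournament, which determines the limit. *)
apply: tournament_limit_eq => T; rewrite GammaE.
have := Gamma'P T; rewrite limit_ind_densityE esum_ordered_partitions.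
by move=> <-.
Qed.
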